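(* Let $q=2^m$, $r=2^h$ with $h\mid m$, and assume $m/h$ is odd. Let $F=\mathbb{F}_q$, $K=\mathbb{F}_{q^2}$, $F'=\mathbb{F}_r$, $K'=\mathbb{F}_{r^2}$, with $F'\subseteq F\subset K$ and $F'\subset K'\subseteq K$. Let $s\ge1$ and let $H'\subset K'=AG(2,r)$ be a KM-arc of type $s$ (an $(r+s,s)$-arc) in $PG(2,r)$ with $s$-nucleus at $0$. Let $V_1=\{x\in F\mid Tr_{F/F'}(x)=1\}$ and $V_c=cV_1$ for some $c\in K^*$. Then $$H:=\{\lambda u\mid 1/\lambda\in V_c,\ u\in H'\}$$ is a KM-arc in $K=AG(2,q)$ of type $t=sq/r$ (a $(q+sq/r,\,sq/r)$-arc) with $t$-nucleus at $0$.
   Context: Relative trace: $Tr_{F/F'}:F\to F'$, $Tr_{F/F'}(x)=x+x^r+\cdots+x^{q/r^2}+x^{q/r}$. Polar representation of planes: for a power $q$ of $2$, $F=\mathbb{F}_q\subset K=\mathbb{F}_{q^2}$, put $\bar x=x^q$, $\langle x,y\rangle=x\bar y+\bar xy\in F$ and $S=\{u\in K\mid u\bar u=1\}$. Points of $PG(2,q)$ are pairs $(x:z)$ with $x\in K$, $z\in F$, $(x,z)\neq(0,0)$, up to multiplication by $F^*$; lines are $[\alpha:\beta]=\{(x:z)\mid\langle\alpha,x\rangle+\beta z=0\}$, $\alpha\in K,\beta\in F$, $(\alpha,\beta)\ne(0,0)$. The affine plane $AG(2,q)=PG(2,q)\setminus[0:1]$ is identified with $K$ via $(x:1)\leftrightarrow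 x$; its lines are $\{x\in K\mid\langle u,x\rangle+\mu=0\}$ with $u\in S$, $\mu\in F$. In the same way (with $r,F',K'$ in place of $q,F,K$) the affine plane $AG(2,r)$ is identified with $K'$. A KM-arc of type $t$ in $PG(2,q)$, also called a $(q+t,t)$-arc of type $(0,2,t)$, is a set of $q+t$ points meeting every line in $0$, $2$ or $t$ points. For $t=1$ it is an oval, whose tangent lines all pass through a unique point, called its nucleus or $1$-nucleus. For $t=2$ it is a hyperoval, and any point not on it is regarded as a $2$-nucleus. For $2<t<q$ it is known that all lines meeting it in exactly $t$ points pass through one common point, called its $t$-nucleus. *)

(* Defs.v *)
From HB Require Import structures.
From mathcomp Require Import all_boot all_order all_algebra.
Set Implicit Arguments.
Unset Strict Implicit.
Unset Printing Implicit Defensive.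
Import GRing.Theory.
Local Open Scope ring_scope.

(* All fields live inside one finite field L.  A pair (B, E) of subfields of L
   with #|B| = q and #|E| = q ^ 2 gives the polar representation of PG(2, q),
   with B in the role of F_q and E in the role of F_(q^2). *)
Section PolarPlane.
Variable L : finFieldType.
Implicit Types (B E : {set L}) (x y z a b : L).

Definition is_subfield B : Prop := GRing.divring_closed B.

Definition pairing B x y : L := x * y ^+ #|B| + x ^+ #|B| * y.

(* (x : z) is encoded as the set of its homogeneous coordinate vectors. *)
Definition ppoint B x z : {set L * L} :=
  [set (k * x, k * z) | k in B :\ 0].

Definition coords B E : {set L * L} := setX E B :\ (0, 0).

Definition ppoints B E : {set {set L * L}} :=
  [set ppoint B p.1 p.2 | p in coords B E].

Definition pline B E a b : {set {set L * L}} :=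
  [set ppoint B p.1 p.2 | p in coords B E & pairing B a p.1 + b * p.2 == 0].

Definition plines B E : {set {set {set L * L}}} :=
  [set pline B E l.1 l.2 | l in coords B E].

Definition affine B x : {set L * L} := ppoint B x 1.

Definition KM_arc B E (t : nat) (A : {set {set L * L}}) : Prop :=
  [/\ A \subset ppoints B E,
      #|A| = (#|B| + t)%N &
      forall l, l \in plines B E -> #|A :&: l| \in [:: 0%N; 2%N; t]].

Definition on_all_secants B E (t : nat) (A : {set {set L * L}})
    (P : {set L * L}) : Prop :=
  forall l, l \in plines B E -> #|A :&: l| = t -> P \in l.

(* A hyperoval (t = 2) has no distinguished nucleus: every point off it counts
   as one.  Otherwise the nucleus is the only point common to all t-secants. *)
Definition nucleus B E (t : nat) (A : {set {set L * L}})
    (N : {set L * L}) : Prop :=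
  N \in ppoints B E /\
  if t == 2%N then (N \notin A : Prop)
  else forall P, P \in ppoints B E -> (on_all_secants B E t A P <-> P = N).

(* x + x^r + ... + x^(q/r) for q = r ^ n. *)
Definition rel_trace (r n : nat) x : L := \sum_(i < n) x ^+ (r ^ i).

Definition trace_one (r n : nat) B : {set L} :=
  [set x in B | rel_trace r n x == 1].

(* {l u | 1/l in V, u in A}.  As 0^-1 = 0 here, V should not contain 0. *)
Definition inv_scaled (V A : {set L}) : {set L} :=
  [set l * u | l in [set l | l^-1 \in V], u in A].

End PolarPlane.

(* Main.v *)
Require Import Defs.
From HB Require Import structures.
From mathcomp Require Import all_boot all_order all_algebra all_field.
From mathcomp Require Import zify ring.
Set Implicit Arguments.
Unset Strict Implicit.
Unset Printing Implicit Defensive.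
Import GRing.Theory.
Local Open Scope ring_scope.

(** Write <a, x> for the pairing.  The proof rests on a description of the arcs
with nucleus 0 that mentions only the pairing ([central_arc]): a set A of
affine points, |A| = q + s, is a KM-arc of type s with nucleus 0 if and only if
0 is not in A, every line that joins 0 to a point of A meets A in s points, and
every line off 0 meets A in 0 or 2 points ([central_arc_of_KM_arc],
[KM_arc_of_central_arc]).

That an arc has this form is a count.  Let s <> 2 and x in A.  Counting the
pairs (a, y) with y in A and <a, y> = <a, x> shows that exactly q - 1 nonzero
normal vectors a, hence just one line, give an s-secant through x.  This line
passes through the nucleus.  If 0 were in A, the only s-secant through 0 would
be the only s-secant at all, and each of its points would be a nucleus.

For the blow-up, H is the set of the points u / (c v) with v in V_1 and u in
H'.  Since n = m / h is odd, F meets K' in F', so (v, u) is determined by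
u / (c v) and two points of H are collinear with 0 exactly when the two values
of u are.  As |V_1| = q / r ([card_trace_fibre]), this gives the size of H and
its sections by the lines through 0.  A line off 0 can be brought, by scaling
its normal vector, to the form in which u / (c v) lies on it if and only if
v = <a, u>_F.  So its points of H correspond to the u in H' such that
Tr_{F/F'} <a, u>_F = 1.  As n is odd, conjugation in K restricts to
conjugation in K', and
  Tr_{F/F'} <a, u>_F = <Tr_{K/K'} a, u>_{F'}   for u in K'
([rel_trace_pairing]).  Hence these u are the points of H' on a line of
AG(2, r) off 0, and there are 0 or 2 of them. *)

(** * Subfields of a finite field as sets of roots *)

Lemma card_roots_lt (L : finFieldType) (p : {poly L}) (A : {set L}) :
  p != 0 -> {in A, forall x, root p x} -> (#|A| < size p)%N.
Proof.
move=> p0 rA; rewrite cardE; apply: max_poly_roots => //; last exact: enum_uniq.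
by apply/allP => x; rewrite mem_enum; apply: rA.
Qed.

Section Subfield.
Variables (L : finFieldType) (B : {set L}).
Hypothesis subB : is_subfield B.

Lemma subfield1 : 1 \in B. Proof. by case: subB. Qed.
Lemma subfieldB x y : x \in B -> y \in B -> x - y \in B.
Proof. by case: subB => _ h _; apply: h. Qed.
Lemma subfield_div x y : x \in B -> y \in B -> x / y \in B.
Proof. by case: subB => _ _; apply. Qed.
Lemma subfield0 : 0 \in B.
Proof. by rewrite -(subrr 1) subfieldB // subfield1. Qed.
Lemma subfieldM x y : x \in B -> y \in B -> x * y \in B.
Proof.
move=> xB yB; rewrite -[y]invrK subfield_div //.
by rewrite -[y^-1]mul1r subfield_div // subfield1.
Qed.
Lemma subfieldV x : x \in B -> x^-1 \in B.
Proof. by move=> xB; rewrite -[x^-1]mul1r subfield_div ?subfield1. Qed.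

Lemma card_subfield_gt1 : (1 < #|B|)%N.
Proof.
by rewrite (cardD1 0) subfield0 (cardD1 1) !inE oner_neq0 subfield1.
Qed.

(** Multiplication by x permutes the nonzero elements of B, so it does not
change their product. *)
Lemma subfield_fermat x : x \in B -> x ^+ #|B| = x.
Proof.
move=> xB; have [->|x0] := eqVneq x 0.
  by rewrite expr0n; case: #|B| card_subfield_gt1.
have cB : #|B| = #|B :\ 0|.+1 by rewrite (cardsD1 0) subfield0.
have P0 : \prod_(y in B :\ 0) y != 0.
  by apply/prodf_neq0 => y; rewrite !inE => /andP[].
apply: (mulIf P0); rewrite cB exprS -mulrA; congr (x * _).
rewrite -prodr_const -big_split /= [RHS](reindex_inj (mulfI x0)) /=.
apply: eq_bigl => y; rewrite !inE mulf_eq0 (negPf x0) /=; congr (_ && _).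
apply/idP/idP => [|xyB]; first exact: subfieldM.
by rewrite -(mulKf x0 y) subfieldM ?subfieldV.
Qed.

(** The polynomial 'X^|B| - 'X has no room for a root outside B. *)
Lemma mem_subfieldE x : (x \in B) = (x ^+ #|B| == x).
Proof.
apply/idP/eqP => [|fx]; first exact: subfield_fermat.
apply/negPn/negP => xB; have q1 := card_subfield_gt1.
pose p : {poly L} := 'X^#|B| - 'X.
have szp : size p = #|B|.+1.
  by rewrite size_polyDl size_polyXn // size_polyN size_polyX ltnS.
have := @card_roots_lt _ p (x |: B); rewrite szp cardsU1 xB ltnn => P.
suff : false by []; apply: P; first by rewrite -size_poly_gt0 szp.
move=> y; rewrite !inE /root /p !hornerE subr_eq0.
by case/predU1P=> [->|/subfield_fermat->//]; rewrite fx.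
Qed.
End Subfield.

(** * The pairing and the lines of the polar plane *)

Section PolarPlane.
Variables (L : finFieldType) (B E : {set L}).
Hypotheses (charL : 2%N \in [pchar L]) (subB : is_subfield B)
  (subE : is_subfield E) (BE : B \subset E) (cardE : #|E| = (#|B| ^ 2)%N)
  (natB : (2%N).-nat #|B|).
Implicit Types (x y a b k z : L) (A : {set L}).
Local Notation q := #|B|.

Lemma addr_eq0_pchar2 x y : (x + y == 0) = (x == y).
Proof. by rewrite addr_eq0 oppr_pchar2. Qed.

Lemma exprD_card x y : (x + y) ^+ q = x ^+ q + y ^+ q.
Proof.
by rewrite exprDn_pchar //; apply: sub_in_pnat natB => p _ /eqP->.
Qed.

Lemma conj_conj x : x \in E -> (x ^+ q) ^+ q = x.
Proof. by move=> xE; rewrite -exprM mulnn -cardE subfield_fermat. Qed.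

Lemma pairing_mem a x : a \in E -> x \in E -> pairing B a x \in B.
Proof.
move=> aE xE; rewrite (mem_subfieldE subB) /pairing exprD_card !exprMn.
by rewrite !conj_conj // addrC.
Qed.

Lemma pairingDr a x y : pairing B a (x + y) = pairing B a x + pairing B a y.
Proof. by rewrite /pairing exprD_card !mulrDr addrACA. Qed.

Lemma pairingZr a x k : k \in B -> pairing B a (k * x) = k * pairing B a x.
Proof.
move=> kB; rewrite /pairing exprMn (subfield_fermat subB kB) mulrDr.
by rewrite !(mulrCA _ k).
Qed.

Lemma pairingC a x : pairing B a x = pairing B x a.
Proof. by rewrite /pairing addrC [a ^+ _ * _]mulrC [a * _]mulrC. Qed.

Lemma pairing0l x : pairing B 0 x = 0.
Proof.
rewrite /pairing mul0r expr0n eqn0Ngt ltnW ?card_subfield_gt1 //.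
by rewrite mul0r addr0.
Qed.

(** <a, x> = 0 says that x / a is fixed by conjugation: the line through 0 with
normal vector a has direction a itself, because the characteristic is 2. *)
Lemma pairing_eq0 a x : a != 0 -> (pairing B a x == 0) = (x / a \in B).
Proof.
move=> a0; rewrite /pairing addr_eq0_pchar2 (mem_subfieldE subB).
by rewrite exprMn exprVn eqr_div ?expf_neq0 // [a * _]mulrC [a ^+ _ * _]mulrC.
Qed.

Lemma pairingZl a x k : k \in B -> pairing B (k * a) x = k * pairing B a x.
Proof. by move=> kB; rewrite pairingC pairingZr // pairingC. Qed.

Lemma pairing0r a : pairing B a 0 = 0.
Proof. by rewrite pairingC pairing0l. Qed.

Lemma pairing_self x : pairing B x x = 0.
Proof. by rewrite /pairing mulrC addrr_pchar2. Qed.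

Lemma ppoint_refl x z : (x, z) \in ppoint B x z.
Proof.
apply/imsetP; exists 1; last by rewrite !mul1r.
by rewrite !inE oner_neq0 subfield1.
Qed.

Lemma ppointZ k x z : k \in B -> k != 0 ->
  ppoint B (k * x) (k * z) = ppoint B x z.
Proof.
move=> kB k0; apply/setP => p; apply/imsetP/imsetP => -[l]; rewrite !inE.
  case/andP=> l0 lB ->; exists (l * k); last by rewrite !mulrA.
  by rewrite !inE mulf_neq0 ?subfieldM.
case/andP=> l0 lB ->; exists (l / k); last by rewrite !mulrA !divfK.
by rewrite !inE mulf_neq0 ?invr_eq0 ?subfield_div.
Qed.

Lemma eq_ppoint x z y w : ppoint B x z = ppoint B y w ->
  exists2 k, k \in B :\ 0 & x = k * y /\ z = k * w.
Proof.
move=> e; have := ppoint_refl x z; rewrite e => /imsetP[k kB [-> ->]].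
by exists k.
Qed.

Lemma affine_inj : injective (affine B).
Proof.
by move=> x y /eq_ppoint[k _ []]; rewrite mulr1 => -> <-; rewrite mul1r.
Qed.

Lemma mem_coords x z :
  (x, z) \in coords B E = [&& (x, z) != (0, 0), x \in E & z \in B].
Proof. by rewrite in_setD1 in_setX. Qed.

Lemma affine_coords x : x \in E -> (x, 1) \in coords B E.
Proof.
by move=> xE; rewrite mem_coords xE subfield1 // xpair_eqE oner_eq0 andbF.
Qed.

Lemma ppoint_in_pline x z a b : (x, z) \in coords B E ->
  (ppoint B x z \in pline B E a b) = (pairing B a x + b * z == 0).
Proof.
move=> xz; apply/imsetP/idP => [[[y w]]|h].
  rewrite inE /= => /andP[_ h] /eq_ppoint[k]; rewrite !inE => /andP[k0 kB].
  case=> -> ->; rewrite pairingZr // mulrCA -mulrDr mulf_eq0.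
  by rewrite (eqP h) eqxx orbT.
by exists (x, z) => //; rewrite inE xz.
Qed.

Lemma affine_in_pline x a b : x \in E ->
  (affine B x \in pline B E a b) = (pairing B a x == b).
Proof.
by move=> xE; rewrite ppoint_in_pline ?affine_coords // mulr1 addr_eq0_pchar2.
Qed.

Lemma card_affineI A a b : A \subset E ->
  #|[set affine B x | x in A] :&: pline B E a b| =
  #|[set x in A | pairing B a x == b]|.
Proof.
move=> AE; rewrite -(card_imset _ affine_inj); congr #|pred_of_set _|.
apply/setP => P; apply/setIP/imsetP => [[/imsetP[x xA ->]]|[x]].
  by rewrite affine_in_pline ?(subsetP AE) // => h; exists x; rewrite // inE xA.
rewrite inE => /andP[xA h] ->; split; first exact: imset_f.
by rewrite affine_in_pline ?(subsetP AE).
Qed.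

Lemma mem_plines a b : (a, b) \in coords B E -> pline B E a b \in plines B E.
Proof. by move=> h; apply/imsetP; exists (a, b). Qed.

(** * Arcs with nucleus 0 *)

(** The points of A on the line [a : b]; the sign of b is immaterial in
characteristic 2. *)
Definition line_section A a b := [set x in A | pairing B a x == b].

(** The normal vectors of the s-secants through x.  Proportional vectors are all
present, so that each s-secant is counted |B| - 1 times. *)
Definition secant_directions s A x :=
  [set a in E :\ 0 | #|line_section A a (pairing B a x)| == s].

Lemma line_sectionZ A a k : k \in B -> k != 0 ->
  line_section A (k * a) 0 = line_section A a 0.
Proof.
move=> kB k0; apply/setP => y.
by rewrite !inE pairingZl // mulf_eq0 (negPf k0).
Qed.

(** The form that a KM-arc of type s with nucleus 0 takes on affine coordinates.
It is uniform in s, whereas the nucleus is defined separately for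
hyperovals. *)
Definition central_arc s A : Prop :=
  [/\ 0 \notin A, #|A| = (q + s)%N,
      {in A, forall x, #|line_section A x 0| = s} &
      forall a b, a \in E -> b \in B -> b != 0 ->
        #|line_section A a b| \in [:: 0%N; 2%N]].

Lemma card_pairing_kernel d : d \in E -> d != 0 ->
  #|[set a in E :\ 0 | pairing B a d == 0]| = q.-1.
Proof.
move=> dE d0.
have -> : [set a in E :\ 0 | pairing B a d == 0] = [set k * d | k in B :\ 0].
  apply/setP => a; apply/idP/imsetP => [|[k kB ->]].
    rewrite !inE pairingC pairing_eq0 // => /andP[/andP[a0 aE] adB].
    by exists (a / d); rewrite ?divfK // !inE adB mulf_neq0 ?invr_eq0.
  move: kB; rewrite !inE => /andP[k0 kB].
  rewrite pairingC pairing_eq0 // mulfK // kB mulf_neq0 //.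
  by rewrite subfieldM // (subsetP BE).
by rewrite card_imset; [rewrite [q](cardsD1 0) subfield0 | exact: mulIf].
Qed.

Lemma card_nonzero : #|E :\ 0| = (q ^ 2).-1.
Proof. by rewrite -cardE [#|E|](cardsD1 0) subfield0. Qed.

(** Double count of the pairs (a, y) with <a, y> = <a, x>: the point y = x
admits every a, and each other y admits the |B| - 1 multiples of y + x. *)
Lemma sum_line_sections A x : A \subset E -> x \in A ->
  (\sum_(a in E :\ 0%R) #|line_section A a (pairing B a x)| =
   (q ^ 2).-1 + #|A|.-1 * q.-1)%N.
Proof.
move=> AE xA.
transitivity (\sum_(a in E :\ 0%R)
  \sum_(y in A | pairing B a y == pairing B a x) 1)%N.
  by apply: eq_bigr => a _; rewrite sum1dep_card.
rewrite (exchange_big_dep (mem A)) //=; last by move=> ? ? _ /andP[].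
rewrite (bigD1 x) //=; congr (_ + _)%N.
  under eq_bigl => a do rewrite xA eqxx !andbT.
  by rewrite sum1_card card_nonzero.
transitivity (\sum_(y in A :\ x) q.-1)%N; last first.
  by rewrite sum_nat_const [#|A|](cardsD1 x) xA.
apply: eq_big => [y|y /andP[yA yx]]; first by rewrite !inE andbC.
have yxE : y + x \in E.
  by rewrite -[x](oppr_pchar2 charL) subfieldB // (subsetP AE).
rewrite -(card_pairing_kernel yxE) ?addr_eq0_pchar2 // sum1dep_card.
apply: eq_card => a; rewrite !inE yA /= pairingDr addr_eq0_pchar2 //.
Qed.

(** Each term of the previous sum is 2 or s, so the sum determines the number N
of terms equal to s: it gives (s - 2) (N - (|B| - 1)) = 0. *)
Lemma card_secant_directions s A x : A \subset E -> #|A| = (q + s)%N ->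
    s != 2%N -> x \in A ->
    {in E :\ 0, forall a,
      #|line_section A a (pairing B a x)| \in [:: 2%N; s]} ->
  #|secant_directions s A x| = q.-1.
Proof.
move=> AE cA s2 xA two; set T := secant_directions _ _ _.
have TE : T \subset E :\ 0 by apply/subsetP => a; rewrite inE => /andP[].
have := sum_line_sections AE xA; rewrite (big_setID T) /= (setIidPr TE).
rewrite (eq_bigr (fun=> s)) => [|a]; last by rewrite inE => /andP[_ /eqP].
rewrite [X in (_ + X)%N](eq_bigr (fun=> 2%N)) => [|a]; last first.
  rewrite !inE => /andP[nT /andP[a0 aE]]; have := two a.
  rewrite !inE a0 aE => /(_ isT) /orP[/eqP-> //|sa].
  by move: nT; rewrite a0 aE sa.
rewrite !sum_nat_const cardsD (setIidPr TE).
have := subset_leq_card TE; rewrite card_nonzero cA.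
have := card_subfield_gt1 subB.
case: q => [|[|Q]] // _; rewrite -[Q.+2.-1]/Q.+1; move: #|T| => N; clear -s2.
have -> : ((Q.+2 ^ 2).-1 = Q.+1 * Q.+3)%N by lia.
case: s s2 => [|[|[|w]]] //= _ NQ eN; [by lia | by lia |].
have /eqP : (w.+1 * N = w.+1 * Q.+1)%N by lia.
by rewrite eqn_pmul2l // => /eqP.
Qed.

Section CentralArc.
Variables (s : nat) (A : {set L}).
Hypotheses (AE : A \subset E) (s_gt0 : (0 < s)%N).
Let P := [set affine B x | x in A].

Let affineP x : (affine B x \in P) = (x \in A).
Proof. by rewrite mem_imset //; apply: affine_inj. Qed.

Let cardP : #|P| = #|A|.
Proof. by rewrite card_imset //; apply: affine_inj. Qed.

Let affine_point x : x \in E -> affine B x \in ppoints B E.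
Proof.
by move=> xE; apply: (imset_f (fun p => ppoint B p.1 p.2) (affine_coords xE)).
Qed.

Lemma nucleus_secants_offset : nucleus B E s P (affine B 0) -> s != 2%N ->
  forall a b, (a, b) \in coords B E -> #|line_section A a b| = s -> b = 0.
Proof.
move=> [N0 nuc] s2; rewrite (negPf s2) in nuc => a b ab lab.
have /(_ (pline B E a b)) := (nuc _ N0).2 erefl.
rewrite card_affineI // mem_plines // affine_in_pline ?subfield0 // pairing0r.
by move=> /(_ isT lab) /eqP.
Qed.

(** For s <> 2 the only s-secant through a point x of A goes through 0, which
makes it the line joining 0 to x, and lines off 0 are not s-secants. *)
Lemma central_arc_of_KM_arc :
  KM_arc B E s P -> nucleus B E s P (affine B 0) -> central_arc s A.
Proof.
move=> [_ cA lineP] nuc; rewrite cardP in cA.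
have line a b : (a, b) \in coords B E ->
    #|line_section A a b| \in [:: 0%N; 2%N; s].
  by move=> ab; rewrite -card_affineI //; apply/lineP/mem_plines.
have lineX x a b : (a, b) \in coords B E -> x \in line_section A a b ->
    #|line_section A a b| \in [:: 2%N; s].
  move=> ab xl; have := line a b ab; rewrite inE => /predU1P[|//].
  by move=> /eqP; rewrite cards_eq0 => /eqP e; rewrite e inE in xl.
have coordsN0 a b : a \in E -> b \in B -> (a != 0) || (b != 0) ->
    (a, b) \in coords B E.
  by move=> aE bB ab; rewrite mem_coords aE bB xpair_eqE negb_and ab.
have [e2|s2] := eqVneq s 2%N.
  move: nuc; rewrite /nucleus e2 eqxx affineP => -[_ A0].
  rewrite e2 in cA lineP line lineX; split=> // [x xA|a b aE bB b0].
    have x0 : x != 0 by apply: contraNneq A0 => <-.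
    have := lineX x x 0; rewrite coordsN0 ?subfield0 ?x0 ?(subsetP AE) //.
    rewrite !inE orbb pairing_self eqxx xA => h.
    by apply/eqP/h.
  by have := line a b; rewrite coordsN0 ?b0 ?orbT // !inE orbb => /(_ isT).
have off := nucleus_secants_offset nuc s2.
have card_dirs x : x \in A -> #|secant_directions s A x| = q.-1.
  move=> xA; apply: card_secant_directions => // a.
  rewrite in_setD1 => /andP[a0 aE].
  apply: (lineX x); last by rewrite inE xA eqxx.
  by rewrite coordsN0 ?a0 // pairing_mem // (subsetP AE).
have ex_dir x : x \in A -> exists a, a \in secant_directions s A x.
  move=> xA; apply/card_gt0P; rewrite card_dirs //.
  by rewrite -subn1 subn_gt0 card_subfield_gt1.
have A0 : 0 \notin A.
  apply/negP => A0; have [a aD] := ex_dir 0 A0.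
  have := aD; rewrite inE in_setD1 pairing0r => /andP[/andP[a0 aE] _].
  (* All s-secants through 0 have a normal vector proportional to a, so the
     affine point a, which lies on [a : 0], is a second common point. *)
  have D_line : [set k * a | k in B :\ 0] = secant_directions s A 0.
    apply/eqP; rewrite eqEcard card_dirs // card_imset; last exact: mulIf.
    rewrite [q](cardsD1 0) subfield0 // leqnn andbT.
    apply/subsetP => _ /imsetP[k kB ->]; move: kB aD.
    rewrite !inE !pairing0r => /andP[k0 kB] /andP[_ la].
    by rewrite mulf_neq0 // (subfieldM subE (subsetP BE k kB) aE) line_sectionZ.
  case: nuc => _; rewrite (negPf s2) => /(_ (affine B a)).
  case/(_ (affine_point aE)) => a_nuc _; move/eqP: a0; apply.
  apply: affine_inj; apply: a_nuc => _ /imsetP[[a' b'] ab' ->] /=.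
  rewrite card_affineI // => l'; have b'0 := off _ _ ab' l'; subst b'.
  move: ab'; rewrite mem_coords xpair_eqE eqxx andbT => /and3P[a'0 a'E _].
  have : a' \in secant_directions s A 0
    by rewrite !inE a'0 a'E pairing0r l' eqxx.
  rewrite -D_line => /imsetP[k]; rewrite !inE => /andP[_ kB] ->.
  by rewrite affine_in_pline // pairingZl // pairing_self mulr0.
split=> // [x xA|a b aE bB b0].
- have [a] := ex_dir x xA; rewrite inE in_setD1 => /andP[/andP[a0 aE] /eqP la].
  have xE := subsetP AE x xA.
  have ax0 : pairing B a x = 0.
    by apply: off la; rewrite coordsN0 ?a0 // pairing_mem.
  have kB : x / a \in B by rewrite -pairing_eq0 // ax0.
  rewrite -{}[RHS]la ax0 -[x in line_section _ x](divfK a0) line_sectionZ //.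
  by rewrite mulf_neq0 ?invr_eq0 //; apply: contraNneq A0 => <-.
- have := line a b; rewrite coordsN0 ?b0 ?orbT // => /(_ isT).
  rewrite !inE => /or3P[->//|->|/eqP l]; rewrite ?orbT //.
  have b_eq0 : b = 0 by apply: (off a) => //; rewrite coordsN0 ?b0 ?orbT.
  by rewrite b_eq0 eqxx in b0.
Qed.

(** For s <> 2, 0 is the only point common to the lines that join it to two
points of A not collinear with it; such points exist as |A| exceeds s. *)
Lemma KM_arc_of_central_arc : central_arc s A ->
  KM_arc B E s P /\ nucleus B E s P (affine B 0).
Proof.
move=> [A0 cA central off].
have thru0 a : a \in E -> a != 0 -> #|line_section A a 0| \in [:: 0%N; s].
  move=> aE a0; have [->|[x xl]] := set_0Vmem (line_section A a 0).
    by rewrite cards0.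
  have [xA /eqP ax0] : x \in A /\ pairing B a x == 0.
    by apply/andP; move: xl; rewrite inE.
  have x0 : x != 0 by apply: contraNneq A0 => <-.
  have kB : x / a \in B by rewrite -pairing_eq0 // ax0.
  have := central x xA; rewrite -{1}[x](divfK a0) line_sectionZ //.
    by move=> ->; rewrite !inE eqxx orbT.
  by rewrite mulf_neq0 ?invr_eq0.
split; first split.
- by apply/subsetP => _ /imsetP[x xA ->]; rewrite affine_point // (subsetP AE).
- by rewrite cardP.
- move=> _ /imsetP[[a b] /= ab ->]; rewrite card_affineI //; move: ab.
  rewrite mem_coords xpair_eqE => /and3P[ab0 aE bB].
  have [b0|b0] := eqVneq b 0.
    move: ab0; rewrite b0 eqxx andbT => /(thru0 a aE).
    by rewrite !inE => /orP[->|->]; rewrite ?orbT.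
  by have := off a b aE bB b0; rewrite !inE => /orP[->|->]; rewrite ?orbT.
split; first by rewrite affine_point // subfield0.
case: eqVneq => [_|s2]; first by rewrite affineP.
move=> Q /imsetP[[y z] yz ->] /=; split=> [on|-> _ /imsetP[[a b] /= ab ->]].
  have [x1 x1A] : exists x, x \in A.
    by apply/card_gt0P; rewrite cA addn_gt0 s_gt0 orbT.
  have [x2 x2A x12] : exists2 x, x \in A & pairing B x1 x != 0.
    have /subsetPn[x xA] : ~~ (A \subset line_section A x1 0).
      apply: contraTN isT => /subset_leq_card; rewrite central // cA.
      rewrite -[X in (_ <= X)%N]add0n leq_add2r leqNgt.
      by rewrite ltnW ?card_subfield_gt1.
    by rewrite inE xA; exists x.
  have perp x : x \in A -> pairing B x y = 0.
    move=> xA; have xE := subsetP AE x xA.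
    have x0 : x != 0 by apply: contraNneq A0 => <-.
    have xc : (x, 0) \in coords B E.
      by rewrite mem_coords xpair_eqE negb_and x0 xE subfield0.
    have := on (pline B E x 0).
    rewrite mem_plines // card_affineI // central //.
    by rewrite ppoint_in_pline // mul0r addr0 => /(_ isT erefl)/eqP.
  have y0 : y = 0.
    apply: contraNeq x12 => y0; have kB : x2 / y \in B.
      by rewrite -pairing_eq0 // pairingC perp.
    by rewrite -[x2](divfK y0) pairingZr // perp // mulr0.
  move: yz; rewrite y0 mem_coords xpair_eqE eqxx /= => /and3P[z0 _ zB].
  by rewrite /affine -[RHS](ppointZ _ _ zB z0) mulr0 mulr1.
rewrite card_affineI // affine_in_pline ?subfield0 // pairing0r eq_sym => l.
move: ab; rewrite mem_coords => /and3P[_ aE bB].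
apply/negPn/negP => /(off a b aE bB); rewrite l !inE.
by rewrite (negPf s2) orbF; case: s s_gt0.
Qed.
End CentralArc.
End PolarPlane.

(** * The relative trace *)

Section RelativeTrace.
Variables (L : finFieldType) (B C : {set L}) (n : nat).
Hypotheses (charL : 2%N \in [pchar L]) (subB : is_subfield B)
  (natB : (2%N).-nat #|B|) (subC : is_subfield C)
  (n_gt0 : (0 < n)%N) (cardC : #|C| = (#|B| ^ n)%N).
Local Notation r := #|B|.
Implicit Types (x y k : L).

Lemma expr_card_sum m (f : 'I_m -> L) :
  (\sum_(i < m) f i) ^+ r = \sum_(i < m) f i ^+ r.
Proof.
apply: (big_morph (fun x => x ^+ r)) => [x y|]; first exact: exprD_card.
by rewrite expr0n eqn0Ngt ltnW ?card_subfield_gt1.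
Qed.

Lemma exprD_card_iter i x y :
  (x + y) ^+ (r ^ i) = x ^+ (r ^ i) + y ^+ (r ^ i).
Proof.
rewrite exprDn_pchar //; apply: sub_in_pnat (_ : 2%N.-nat _) => [p _ /eqP->//|].
by rewrite pnatX natB.
Qed.

Lemma expr_card_iter i k : k \in B -> k ^+ (r ^ i) = k.
Proof.
move=> kB; elim: i => [|i IHi]; first by rewrite expn0 expr1.
by rewrite expnS exprM subfield_fermat.
Qed.

Lemma rel_traceZ m k x : k \in B -> rel_trace r m (k * x) = k * rel_trace r m x.
Proof.
move=> kB; rewrite /rel_trace mulr_sumr; apply: eq_bigr => i _.
by rewrite exprMn (expr_card_iter _ kB).
Qed.

Lemma rel_trace0 m : rel_trace r m (0 : L) = 0.
Proof. by have := rel_traceZ m (0 : L) (subfield0 subB); rewrite !mul0r. Qed.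

(** Raising to the power |B| rotates the terms of the trace. *)
Lemma rel_trace_mem x : x \in C -> rel_trace r n x \in B.
Proof.
move=> xC; rewrite (mem_subfieldE subB) expr_card_sum.
have := subfield_fermat subC xC; rewrite cardC; case: n n_gt0 => // m _ xm.
rewrite /rel_trace big_ord_recr big_ord_recl /= -exprM -expnSr xm expr1 addrC.
by apply/eqP; congr (_ + _); apply: eq_bigr => i _; rewrite -exprM -expnSr.
Qed.

(** The fibre consists of roots of a polynomial of degree |B| ^ n.-1. *)
Lemma card_trace_fibre_le k :
  (#|[set x in C | rel_trace r n x == k]| <= r ^ n.-1)%N.
Proof.
case: n n_gt0 => // m _ /=; set T := [set x in _ | _].
have r1 := card_subfield_gt1 subB.
pose p : {poly L} := 'X^(r ^ m) + (\sum_(i < m) 'X^(r ^ i) - k%:P).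
have szp : size p = (r ^ m).+1.
  rewrite size_polyDl size_polyXn // ltnS (leq_trans (size_polyD _ _)) //.
  rewrite geq_max size_polyN andbC.
  rewrite (leq_trans (size_polyC_leq1 _)) ?expn_gt0 ?(ltnW r1) //=.
  apply: leq_trans (size_sum _ _ _) _; apply/bigmax_leqP => i _.
  by rewrite size_polyXn ltn_exp2l.
rewrite -ltnS -szp; apply: card_roots_lt => [|x].
  by rewrite -size_poly_gt0 szp.
rewrite inE /root => /andP[_ /eqP tx].
rewrite hornerD hornerXn hornerD hornerN hornerC horner_sum -tx /rel_trace.
under eq_bigr => i _ do rewrite hornerXn.
by rewrite big_ord_recr /= addrA [X in X - _]addrC subrr.
Qed.

(** The |B| fibres cover the |B| ^ n elements of C, so the upper bound on each
of them is attained. *)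
Lemma card_trace_fibre k : k \in B ->
  #|[set x in C | rel_trace r n x == k]| = (r ^ n.-1)%N.
Proof.
move=> kB; apply/eqP; rewrite eqn_leq card_trace_fibre_le /=.
have : #|C| = (\sum_(j in B) #|[set x in C | rel_trace r n x == j]|)%N.
  rewrite -sum1_card (partition_big (rel_trace r n) (mem B)) //=.
    by apply: eq_bigr => j _; rewrite sum1dep_card.
  exact: rel_trace_mem.
have others : (\sum_(j in B | j != k) #|[set x in C | rel_trace r n x == j]|
    <= #|B :\ k| * r ^ n.-1)%N.
  rewrite -sum_nat_const [leqRHS](eq_bigl (fun j => (j \in B) && (j != k))).
    by apply: leq_sum => j _; apply: card_trace_fibre_le.
  by move=> j; rewrite !inE andbC.
have -> : #|C| = (r ^ n.-1 + #|B :\ k| * r ^ n.-1)%N.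
  have cB : r = #|B :\ k|.+1 by rewrite (cardsD1 k) kB.
  by rewrite cardC -{1}(prednK n_gt0) expnS -mulSn -cB.
rewrite (bigD1 k) //= => e.
by rewrite -(leq_add2r (#|B :\ k| * r ^ n.-1)) e leq_add2l.
Qed.
End RelativeTrace.

Lemma sum_ord_double (V : nmodType) (f : nat -> V) n :
  \sum_(i < n + n) f i = \sum_(j < n) (f j.*2 + f j.*2.+1).
Proof.
elim: n => [|n IHn]; first by rewrite !big_ord0.
by rewrite addSn addnS 2!big_ord_recr IHn [RHS]big_ord_recr /= addnn addrA.
Qed.

Lemma card_imset_sep (T U : finType) (g : T -> U) (D : {set T}) (P : pred U) :
  {in D &, injective g} ->
  #|[set x in [set g p | p in D] | P x]| = #|[set p in D | P (g p)]|.
Proof.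
move=> g_inj; rewrite -(@card_in_imset _ _ g); last first.
  by move=> x y; rewrite !inE => /andP[xD _] /andP[yD _]; apply: g_inj.
apply: eq_card => x; apply/idP/imsetP.
  by rewrite inE => /andP[/imsetP[p pD ->] Pp]; exists p; rewrite // inE pD.
by case=> p; rewrite !inE => /andP[pD Pp] ->; rewrite Pp imset_f.
Qed.

(** * Extensions of odd degree *)

Section OddExtension.
Variables (L : finFieldType) (F F' K' : {set L}) (n : nat).
Hypotheses (charL : 2%N \in [pchar L]) (subF : is_subfield F)
  (subF' : is_subfield F') (subK' : is_subfield K')
  (natF' : (2%N).-nat #|F'|) (n_odd : odd n)
  (cardF : #|F| = (#|F'| ^ n)%N) (cardK' : #|K'| = (#|F'| ^ 2)%N)
  (cardL : #|L| = (#|F| ^ 2)%N) (F'F : F' \subset F).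
Local Notation r := #|F'|.

Let n_gt0 : (0 < n)%N. Proof. by rewrite odd_gt0. Qed.

Let subT : is_subfield [set: L].
Proof. by split=> [|x y _ _|x y _ _]; rewrite inE. Qed.

Let cardT : #|[set: L]| = (#|F| ^ 2)%N. Proof. by rewrite cardsT. Qed.

Let natF : (2%N).-nat #|F|. Proof. by rewrite cardF pnatX natF'. Qed.

Let natK' : (2%N).-nat #|K'|. Proof. by rewrite cardK' pnatX natF'. Qed.

(** K' has degree 2 over F', so an odd number of iterations of the r-th power
map acts on it as a single one. *)
Lemma conj_odd u : u \in K' -> u ^+ #|F| = u ^+ r.
Proof.
move=> uK'; rewrite cardF -(odd_double_half n) n_odd -mul2n.
by rewrite expnD mulnC exprM expnM -cardK' (expr_card_iter subK') // expn1.
Qed.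

Lemma odd_extension_cap x : x \in F -> x \in K' -> x \in F'.
Proof.
by move=> xF xK'; rewrite (mem_subfieldE subF') -conj_odd // subfield_fermat.
Qed.

(** With x = a u^r one has <a, u>_F = x + x^q, so the left side is the sum of
all x^(r^i) with i < 2 n.  The terms with even i form Tr_{K/K'}(a) u^r, and
those with odd i are their r-th powers. *)
Lemma rel_trace_pairing a u : u \in K' ->
  rel_trace r n (pairing F a u) = pairing F' (rel_trace #|K'| n a) u.
Proof.
move=> uK'.
have uu : (u ^+ r) ^+ r = u by apply: (conj_conj subK').
pose x := a * u ^+ r.
have -> : pairing F a u = x + x ^+ #|F|.
  by rewrite /pairing conj_odd // exprMn exprAC (conj_odd uK') uu.
transitivity (\sum_(i < n + n) x ^+ (r ^ i)).
  rewrite big_split_ord /= -big_split; apply: eq_bigr => i _ /=.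
  by rewrite (exprD_card_iter charL natF') cardF -exprM -expnD.
rewrite (sum_ord_double (fun i => x ^+ (r ^ i))) big_split /= /pairing.
rewrite /rel_trace (expr_card_sum charL subF') // !mulr_suml.
congr (_ + _); apply: eq_bigr => j _.
  rewrite -mul2n expnM -cardK' exprMn; congr (_ * _).
  by rewrite exprAC (expr_card_iter subK').
by rewrite expnSr exprM -mul2n expnM -cardK' !exprMn
  [u ^+ _ ^+ _]exprAC (expr_card_iter _ _ uK') // uu.
Qed.

(** * Blowing up an arc *)

Section Blowup.
Variables (s : nat) (A : {set L}) (c : L).
Hypotheses (AK' : A \subset K') (c0 : c != 0) (central : central_arc F' K' s A).
Let V := trace_one r n F.
Let H := inv_scaled [set c * v | v in V] A.
Let g (p : L * L) := p.2 / (c * p.1).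

Let memV v : (v \in V) = (v \in F) && (rel_trace r n v == 1).
Proof. by rewrite inE. Qed.

Let V_neq0 v : v \in V -> v != 0.
Proof.
rewrite memV => /andP[_]; apply: contraTneq => ->.
by rewrite rel_trace0 // eq_sym oner_eq0.
Qed.

Let A_neq0 u : u \in A -> u != 0.
Proof. by case: central => A0 _ _ _; apply: contraTneq => ->. Qed.

Let HE : H = [set g p | p in setX V A].
Proof.
apply/setP => x; apply/imset2P/imsetP => [[l u]|[[v u]]].
  rewrite inE => /imsetP[v vV lE] uA ->; exists (v, u).
    by rewrite in_setX vV.
  by rewrite /g /= -lE invrK mulrC.
rewrite in_setX => /andP[vV uA] ->.
exists (c * v)^-1 u => //; last exact: mulrC.
by rewrite inE invrK imset_f.
Qed.

(** If u / v = u' / v', then k = u / u' = v / v' lies in both F and K', hence in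
F', so 1 = Tr v = k Tr v' = k. *)
Let g_inj : {in setX V A &, injective g}.
Proof.
move=> [v u] [v' u']; rewrite !in_setX /= => /andP[vV uA] /andP[v'V u'A].
have [v0 v'0] := (V_neq0 vV, V_neq0 v'V).
rewrite /g /= => /eqP; rewrite eqr_div ?mulf_neq0 // => /eqP e.
have e1 : u * v' = u' * v by apply: (mulfI c0); rewrite mulrCA e mulrCA.
have u'0 := A_neq0 u'A.
have kE : u / u' = v / v'.
  by apply/eqP; rewrite eqr_div // e1 mulrC.
have kF' : v / v' \in F'.
  move: vV v'V; rewrite !memV => /andP[vF _] /andP[v'F _].
  apply: odd_extension_cap; first exact: subfield_div.
  by rewrite -kE subfield_div // (subsetP AK').
have k1 : v / v' = 1.
  move: vV v'V; rewrite !memV => /andP[_ /eqP t] /andP[_ /eqP t'].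
  by rewrite -t -[v in RHS](divfK v'0) rel_traceZ // t' mulr1.
by rewrite -(divfK v'0 v) -(divfK u'0 u) kE k1 !mul1r.
Qed.

Let card_V : #|V| = (r ^ n.-1)%N.
Proof. by apply: card_trace_fibre => //; apply: subfield1. Qed.

(** Both kinds of section of H are read off in V x A.  On a line through 0 they
are V times a section of A by a line through 0; on any other line, v is
determined by u, and the admissible u form a section of A by a line off 0. *)
Lemma central_arc_blowup : central_arc F [set: L] (s * r ^ n.-1) H.
Proof.
have [A0 cA thru off] := central.
split.
- apply/negP; rewrite HE => /imsetP[[v u]].
  rewrite in_setX => /andP[vV uA] /eqP.
  rewrite eq_sym /g mulf_eq0 invr_eq0 mulf_eq0 (negPf c0) /=.
  by rewrite (negPf (V_neq0 vV)) (negPf (A_neq0 uA)).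
- rewrite HE card_in_imset // cardsX card_V cA mulnDr cardF.
  by rewrite -expnSr prednK // mulnC.
- move=> x0; rewrite HE => /imsetP[[v0 u0]].
  rewrite in_setX => /andP[v0V u0A] ->.
  rewrite /line_section card_imset_sep //.
  rewrite -[in RHS](thru u0 u0A) mulnC -card_V -cardsX.
  apply: eq_card => -[v u].
  rewrite [LHS]inE !in_setX [u \in line_section _ _ _ _]inE /=.
  case vV : (v \in V) => //=; case uA : (u \in A) => //=.
  have [[v0_0 v_0] u0_0] := (V_neq0 v0V, V_neq0 vV, A_neq0 u0A).
  rewrite !pairing_eq0 // ?mulf_neq0 ?invr_eq0 ?mulf_neq0 //.
  have -> : g (v, u) / g (v0, u0) = u / u0 * (v0 / v).
    by rewrite /g /=; field; rewrite c0 v_0 v0_0 u0_0.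
  have vF : v0 / v \in F.
    move: vV v0V; rewrite !memV => /andP[vF _] /andP[v0F _].
    exact: subfield_div.
  apply/idP/idP => [uF|uF']; last by rewrite subfieldM // (subsetP F'F).
  apply: odd_extension_cap; last by rewrite subfield_div // (subsetP AK').
  have w0 : v0 / v != 0 by rewrite mulf_neq0 ?invr_eq0.
  by rewrite -(mulfK w0 (u / u0)) subfield_div.
- move=> a b _ bF b0; rewrite HE /line_section card_imset_sep //.
  (* For this normal vector, u / (c v) is on [a : b] iff <a1, u> = v. *)
  pose a1 := a / (b * c ^+ #|F|).
  have a1E v u : v \in V -> pairing F a (g (v, u)) = b / v * pairing F a1 u.
    move=> vV; have v0 := V_neq0 vV; move: vV; rewrite memV => /andP[vF _].
    have cc : (c ^+ #|F|) ^+ #|F| = c by apply: (conj_conj subT); rewrite ?inE.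
    rewrite /pairing /g /a1 /= !(exprMn, exprVn) cc.
    rewrite (subfield_fermat subF vF) (subfield_fermat subF bF).
    by field; rewrite c0 v0 b0 expf_neq0.
  have aK' : rel_trace #|K'| n a1 \in K'.
    apply: (rel_trace_mem charL subK' natK' subT n_gt0); last by rewrite inE.
    by rewrite cardT cardF cardK' -!expnM mulnC.
  have := off _ 1 aK' (subfield1 subF') (oner_neq0 _).
  rewrite /line_section; set S' := [set u in _ | _]; set S := [set p in _ | _].
  suff -> : S = [set (pairing F a1 u, u) | u in S'].
    by rewrite card_imset // => u u' [].
  apply/setP => -[v u]; rewrite inE in_setX; apply/idP/imsetP => /=.
    case/andP=> /andP[vV uA]; rewrite a1E //; have v0 := V_neq0 vV.
    move: vV; rewrite memV => /andP[vF /eqP tv] /eqP e.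
    have vE : pairing F a1 u = v.
      apply: (mulfI (mulf_neq0 b0 (_ : v^-1 != 0))); rewrite ?invr_eq0 //.
      by rewrite divfK.
    exists u; last by rewrite vE.
    by rewrite inE uA -rel_trace_pairing ?vE ?tv ?eqxx // (subsetP AK').
  case=> u'; rewrite inE => /andP[uA tu] [-> ->].
  have vV : pairing F a1 u' \in V.
    rewrite memV (pairing_mem charL subF subT) ?inE //=.
    by rewrite rel_trace_pairing ?(subsetP AK').
  by rewrite vV uA a1E // divfK ?eqxx // V_neq0.
Qed.
End Blowup.
End OddExtension.

Theorem theorem4 (m h q r : nat) (hq : q = (2 ^ m)%N) (hr : r = (2 ^ h)%N)
    (hdvd : (h %| m)%N) (hodd : odd (m %/ h))
    (K : finFieldType) (F F' K' : {set K})
    (cardK : #|K| = (q ^ 2)%N)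
    (subF : is_subfield F) (cardF : #|F| = q)
    (subF' : is_subfield F') (cardF' : #|F'| = r)
    (subK' : is_subfield K') (cardK' : #|K'| = (r ^ 2)%N)
    (F'F : F' \subset F) (F'K' : F' \subset K')
    (s : nat) (hs : (1 <= s)%N) (H' : {set K}) (H'K' : H' \subset K')
    (arcH' : KM_arc F' K' s [set affine F' x | x in H'])
    (nucH' : nucleus F' K' s [set affine F' x | x in H'] (affine F' 0))
    (c : K) (hc : c != 0) :
  let V1 := trace_one r (m %/ h) F in
  let Vc := [set c * v | v in V1] in
  let H := inv_scaled Vc H' in
  let t := ((s * q) %/ r)%N in
  KM_arc F [set: K] t [set affine F x | x in H] /\
  nucleus F [set: K] t [set affine F x | x in H] (affine F 0).
Proof.
set n := (m %/ h)%N.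
have n_gt0 : (0 < n)%N by rewrite odd_gt0.
have q_rn : q = (r ^ n)%N by rewrite hq hr -expnM mulnC divnK.
have r_gt0 : (0 < r)%N by rewrite hr expn_gt0.
have natr : 2%N.-nat r by rewrite hr pnatX pnat_id.
have charK : 2%N \in [pchar K].
  by apply: (@card_finPcharP _ _ (m * 2)); rewrite // cardK hq -expnM.
move=> V1 Vc H t.
have tE : t = (s * r ^ n.-1)%N.
  by rewrite /t q_rn -(prednK n_gt0) expnSr mulnA mulnK.
have central' : central_arc F' K' s H'.
  by apply: (central_arc_of_KM_arc _ _ _ F'K') => //; rewrite cardF'.
apply: KM_arc_of_central_arc => //.
- by split=> [|x y _ _|x y _ _]; rewrite inE.
- by rewrite tE muln_gt0 hs expn_gt0 r_gt0.
rewrite tE /H /Vc /V1 -cardF'.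
apply: (central_arc_blowup (K' := K')) => //; rewrite ?cardF' ?cardF //.
Qed.
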